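(* Let $I_j$ ($j\ge 0$) be the coefficients of the asymptotic series $I(n)\sim\sum_{j=0}^\infty \frac{I_j}{n^j}$, $n\to\infty$, of $I(n)=\int_0^1[x^n+(1-x)^n]^{1/n}\,dx$. For every integer $p\ge 2$, $I_p$ is a polynomial with rational coefficients in the ordinary zeta values $\zeta(i)=\sum_{m\ge1}m^{-i}$, $i\ge 2$ an integer.
   Context: The asymptotic series means that for every $N\ge 0$, $I(n)=\sum_{j=0}^N I_j n^{-j}+O(n^{-N-1})$ as $n\to\infty$; such a series exists and the coefficients $I_j$ are uniquely determined. *)

(* Defs.v *)
From HB Require Import structures.
From mathcomp Require Import all_boot all_order all_algebra.
From mathcomp Require Import all_classical all_reals all_analysis.
(* Not imported: the notations of mpoly clash with those of all_analysis. *)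
From mathcomp Require mpoly.

Set Implicit Arguments.
Unset Strict Implicit.
Unset Printing Implicit Defensive.

Import Order.TTheory GRing.Theory Num.Theory.
Import numFieldNormedType.Exports.

Local Open Scope classical_set_scope.
Local Open Scope ring_scope.

(* The value at n = 0 is irrelevant: only n --> oo matters. *)
Definition int_I (R : realType) (n : nat) : R :=
  \int[@lebesgue_measure R]_(x in `[0, 1])
    ((x ^+ n + (1 - x) ^+ n) `^ (n%:R^-1)).

(* The index n ranges over the natural numbers. *)
Definition asymptotic_series (R : realType) (f : nat -> R) (c : nat -> R) :
    Prop :=
  forall N : nat,
    (fun n : nat => f n - \sum_(j < N.+1) c j * n%:R ^- j)
      =O_\oo (fun n : nat => n%:R ^- N.+1 : R).

(* The summation index is shifted by one; meaningful for 2 <= i. *)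
Definition zeta (R : realType) (i : nat) : R :=
  limn (series (fun m : nat => m.+1%:R ^- i : R)).

(* The variable of index i is sent to zeta (i + 2), so that k variables stand
   for zeta 2, ..., zeta (k + 1). *)
Definition is_rat_poly_in_zetas (R : realType) (x : R) : Prop :=
  exists (k : nat) (P : mpoly.mpoly k rat),
    x = mpoly.mmap (@ratr R) (fun i : 'I_k => zeta R i.+2) P.

(* Main.v *)
Require Import Defs.
From mathcomp Require Import all_boot all_order all_algebra.
From mathcomp Require Import all_classical all_reals all_analysis.
From mathcomp Require Import ring lra zify.
From mathcomp Require Import -(notations) mpoly.

Set Implicit Arguments.
Unset Strict Implicit.
Unset Printing Implicit Defensive.

Import Order.TTheory GRing.Theory Num.Theory.
Import numFieldNormedType.Exports.

Local Open Scope classical_set_scope.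
Local Open Scope ring_scope.

(** Write e = 1/n.  Three ideas prove the theorem.

    1. An integration by parts on the curve a^n + b^n = 1, parametrized by
    a = x / N, b = (1 - x) / N with N the n-norm of (x, 1 - x), gives
      I(n) = 1 - ((1 - e) / 2) int_0^1 du / (u^e + (1 - u)^e),
    where u = a^n, so that u^e = a and (1 - u)^e = b [int_I_coord].

    2. As a and b are close to 1, 1 / (a + b) is well approximated by
    (a + b) / (4 a b) times a truncated geometric series in
    - (a - b)^2 / (4 a b) [geometric_split].  This is a rational combination,
    independent of n, of monomials a^i b^j with i + j = - 1; the error is an
    arbitrarily high power of e [gap_remainder].  Hence I(n) is, up to such an
    error, a rational combination of 1 and of the numbers
      (1 + x + y) B(1 + x, 1 + y) with x = i e and y = j e
    [coord_integral_expansion].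

    3. Such a number equals Gamma (1 + x) Gamma (1 + y) / Gamma (1 + x + y),
    that is, the infinite product over s >= 1 of
    s (s + x + y) / ((s + x) (s + y)) [cvg_gamma_product_moment], whose
    logarithm is
      sum_(k >= 2) ((-1)^(k-1) / k) ((x + y)^k - x^k - y^k) zeta(k)
    [ln_gamma_bound].  Taking exponentials, each of these numbers has an
    expansion in powers of e whose coefficients are rational polynomials in
    zeta 2, zeta 3, ... [expands_moment].

    The coefficients of an asymptotic series being unique
    [asymptotic_series_coef], those of I(n) are such polynomials.

    Expanding the integrand of I(n) itself on each half of [0, 1] would produce
    alternating multiple zeta values; the symmetry between a and b, kept in
    steps 1 and 2, makes them disappear.

    Everything is computed in the variable x: since e = 1/n, the powers of u and
    1 - u that occur are integral powers of the smooth functions a and b, and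
    all integrands are continuous on [0, 1], even though the Beta integrands are
    unbounded in the variable u. *)

(** * Integrals of continuous functions over the unit interval *)

Section UnitIntervalIntegral.
Context {R : realType}.
Implicit Types f g F : R -> R.

Definition int01 f : R := \int[@lebesgue_measure R]_(x in `[0, 1]) f x.

Lemma integrable01 f : continuous f ->
  (@lebesgue_measure R).-integrable `[0, 1] (EFin \o f).
Proof.
move=> cf; apply: continuous_compact_integrable; first exact: segment_compact.
exact: continuous_subspaceT.
Qed.

Lemma eq_int01 f g : (forall x, 0 <= x <= 1 -> f x = g x) -> int01 f = int01 g.
Proof.
move=> fg; apply: eq_Rintegral => x; rewrite inE /= in_itv /=; exact: fg.
Qed.

Lemma int01D f g : continuous f -> continuous g ->
  int01 (fun x => f x + g x) = int01 f + int01 g.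
Proof. by move=> cf cg; apply: RintegralD => //; exact: integrable01. Qed.

Lemma int01Z r f : continuous f -> int01 (fun x => r * f x) = r * int01 f.
Proof. by move=> cf; apply: RintegralZl => //; exact: integrable01. Qed.

Lemma int01B f g : continuous f -> continuous g ->
  int01 (fun x => f x - g x) = int01 f - int01 g.
Proof. by move=> cf cg; apply: RintegralB => //; exact: integrable01. Qed.

Lemma le_int01 f g : continuous f -> continuous g ->
  (forall x, 0 <= x <= 1 -> f x <= g x) -> int01 f <= int01 g.
Proof.
move=> cf cg fg; apply: le_Rintegral; try exact: integrable01.
  exact: measurable_itv.
by move=> x; rewrite /= in_itv /=; exact: fg.
Qed.

Lemma int01_cst r : int01 (fun=> r) = r.
Proof.
rewrite /int01 Rintegral_cst //= lebesgue_measure_itv /=.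
by rewrite lte_fin ltr01 oppr0 adde0 mulr1.
Qed.

Lemma is_derive_continuous F f :
  (forall x : R, is_derive x 1 F (f x)) -> continuous F.
Proof.
by move=> dF x; apply/differentiable_continuous/derivable1_diffP/ex_derive.
Qed.

Lemma int01_FTC F f : continuous f -> (forall x : R, is_derive x 1 F (f x)) ->
  int01 f = F 1 - F 0.
Proof.
move=> cf dF; have cF := is_derive_continuous dF.
rewrite /int01 /Rintegral (@continuous_FTC2 _ f F 0 1) //=.
- exact: continuous_subspaceT.
- split; first by move=> x _; exact: ex_derive.
  + exact/cvg_at_right_filter/cF.
  + exact/cvg_at_left_filter/cF.
- by move=> x _; rewrite derive1E; apply: derive_val.
Qed.

End UnitIntervalIntegral.

(** * Continuity and derivatives of pointwise expressions *)

Section ContinuousOps.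
Context {R : realType}.
Implicit Types f g : R -> R.

Lemma continuous_add f g : continuous f -> continuous g ->
  continuous (fun x => f x + g x).
Proof. by move=> cf cg x; apply: cvgD; [exact: cf|exact: cg]. Qed.

Lemma continuous_sub f g : continuous f -> continuous g ->
  continuous (fun x => f x - g x).
Proof. by move=> cf cg x; apply: cvgB; [exact: cf|exact: cg]. Qed.

Lemma continuous_mul f g : continuous f -> continuous g ->
  continuous (fun x => f x * g x).
Proof. by move=> cf cg x; apply: cvgM; [exact: cf|exact: cg]. Qed.

Lemma continuous_exp f k : continuous f -> continuous (fun x => f x ^+ k).
Proof.
move=> cf; elim: k => [|k IH]; first by move=> x; exact: cvg_cst.
by under [X in continuous X]eq_fun do rewrite exprS; exact: continuous_mul.
Qed.

Lemma continuous_const (c : R) : continuous (fun _ : R => c).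
Proof. by move=> x; exact: cvg_cst. Qed.

End ContinuousOps.

Ltac solve_continuous := repeat first
  [ assumption | exact: continuous_const | apply: continuous_exp
  | apply: continuous_mul | apply: continuous_sub | apply: continuous_add ].

(** Stated on lambda-abstractions, so that these rules can be chained by
    unification. *)
Section PointwiseDerivatives.
Context {R : realType}.
Implicit Types (f g : R -> R) (x : R).

Lemma is_derive_add f g x df dg : is_derive x 1 f df -> is_derive x 1 g dg ->
  is_derive x 1 (fun y => f y + g y) (df + dg).
Proof. exact: is_deriveD. Qed.

Lemma is_derive_sub f g x df dg : is_derive x 1 f df -> is_derive x 1 g dg ->
  is_derive x 1 (fun y => f y - g y) (df - dg).
Proof. exact: is_deriveB. Qed.

Lemma is_derive_mul f g x df dg : is_derive x 1 f df -> is_derive x 1 g dg ->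
  is_derive x 1 (fun y => f y * g y) (f x * dg + g x * df).
Proof. exact: is_deriveM. Qed.

Lemma is_derive_exp f k x df : is_derive x 1 f df ->
  is_derive x 1 (fun y => f y ^+ k) (k%:R * f x ^+ k.-1 * df).
Proof.
move=> dfx; have -> : (fun y => f y ^+ k) = f ^+ k.
  by apply/funext => y; rewrite fctE.
exact: is_deriveX.
Qed.

Lemma is_derive_inv f x df : f x != 0 -> is_derive x 1 f df ->
  is_derive x 1 (fun y => (f y)^-1) (- (f x) ^- 2 * df).
Proof. by move=> fx dfx; exact: is_deriveV. Qed.

Lemma is_derive_const (c x : R) : is_derive x 1 (fun _ : R => c) 0.
Proof. exact: is_derive_cst. Qed.

Lemma is_derive_var (x : R) : is_derive x 1 (fun y : R => y) 1.
Proof. exact: is_derive_id. Qed.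

End PointwiseDerivatives.

Ltac solve_derive := repeat first
  [ eassumption | exact: is_derive_const | exact: is_derive_var
  | apply: is_derive_exp | apply: is_derive_mul | apply: is_derive_sub
  | apply: is_derive_add ].

(** * The curve a^n + b^n = 1 *)

Section SuperellipseCurve.
Context {R : realType} (n : nat) (n_gt0 : (0 < n)%N).
Implicit Types x : R.

(** The point (acoord x, bcoord x) is the radial projection of (x, 1 - x) onto
    the curve a^n + b^n = 1, and pnorm x is the n-norm of (x, 1 - x).  As
    x^n + (1 - x)^n is positive on the whole line, these functions are smooth
    everywhere and no care is needed at 0 and 1. *)
Definition pnorm x : R := (x ^+ n + (1 - x) ^+ n) `^ n%:R^-1.
Definition acoord x : R := x / pnorm x.
Definition bcoord x : R := (1 - x) / pnorm x.

Let n_neq0 : n%:R != 0 :> R.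
Proof. by rewrite pnatr_eq0 -lt0n. Qed.

Lemma exprn_sum_gt0 (u v : R) : `|u| < v -> 0 < u ^+ n + v ^+ n.
Proof.
move=> uv; rewrite -ltrBlDl sub0r.
have : `|u ^+ n| < v ^+ n by rewrite normrX ltrXn2r -?lt0n ?normr_ge0.
by rewrite ltr_norml => /andP[+ _]; rewrite ltrNl.
Qed.

Lemma psum_gt0 x : 0 < x ^+ n + (1 - x) ^+ n.
Proof.
have [xh|xh|->] := ltgtP x 2^-1.
- by apply: exprn_sum_gt0; rewrite ltr_norml; lra.
- by rewrite addrC; apply: exprn_sum_gt0; rewrite ltr_norml; lra.
- by rewrite addr_gt0 // exprn_gt0 //; lra.
Qed.

Lemma pnorm_gt0 x : 0 < pnorm x.
Proof. exact/powR_gt0/psum_gt0. Qed.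

Let pnorm_neq0 x : pnorm x != 0.
Proof. by rewrite gt_eqF ?pnorm_gt0. Qed.

Lemma pnormXn x : pnorm x ^+ n = x ^+ n + (1 - x) ^+ n.
Proof.
rewrite -powR_mulrn ?powR_ge0 // -powRrM mulVf // powRr1 //.
exact/ltW/psum_gt0.
Qed.

Lemma coordXnD x : acoord x ^+ n + bcoord x ^+ n = 1.
Proof.
by rewrite !expr_div_n -mulrDl -pnormXn mulfV // expf_neq0.
Qed.

Lemma coordD x : acoord x + bcoord x = (pnorm x)^-1.
Proof. by rewrite -mulrDl addrCA subrr addr0 mul1r. Qed.

Lemma is_derive_pnorm x :
  is_derive x 1 pnorm (acoord x ^+ n.-1 - bcoord x ^+ n.-1).
Proof.
have ds : is_derive x (1 : R) (fun x : R => x ^+ n + (1 - x) ^+ n)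
    (n%:R * x ^+ n.-1 - n%:R * (1 - x) ^+ n.-1).
  apply: is_derive_eq; first by solve_derive.
  by rewrite /=; ring.
have := @is_derive1_comp _ (fun y => y `^ n%:R^-1) _ x _ _
  (is_derive1_powR n%:R^-1 (psum_gt0 x)) ds.
move=> dN; apply: (is_derive_eq dN).
rewrite powRB; last by apply/implyP => _; rewrite gt_eqF ?psum_gt0.
rewrite powRr1; last exact/ltW/psum_gt0.
rewrite -/(pnorm x) -pnormXn !expr_div_n.
have -> : pnorm x ^+ n = pnorm x * pnorm x ^+ n.-1 by rewrite -exprS prednK.
have N0 := pnorm_neq0 x; have Nn0 : pnorm x ^+ n.-1 != 0 by rewrite expf_neq0.
have nn := n_neq0.
by field; apply/and3P.
Qed.

Lemma coordXpredD x :
  acoord x * acoord x ^+ n.-1 + bcoord x * bcoord x ^+ n.-1 = 1.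
Proof. by rewrite -!exprS prednK // coordXnD. Qed.

(** The point moves along the curve with velocity proportional to
    (b^(n-1), - a^(n-1)), which is orthogonal to the gradient of a^n + b^n. *)
Lemma is_derive_acoord x :
  is_derive x 1 acoord (bcoord x ^+ n.-1 * (acoord x + bcoord x) ^+ 2).
Proof.
have dN := is_derive_pnorm x; have dNV := is_derive_inv (pnorm_neq0 x) dN.
have dx := is_derive_var x; apply: (is_derive_eq (is_derive_mul dx dNV)).
have := coordXpredD x; rewrite coordD.
set p := acoord x ^+ _; set q := bcoord x ^+ _.
rewrite /acoord /bcoord; have N0 := pnorm_neq0 x => pq.
have {}pq : x * p + (1 - x) * q = pnorm x.
  by transitivity (pnorm x * (x / pnorm x * p + (1 - x) / pnorm x * q));
    [field | rewrite pq mulr1].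
have -> : x * (- pnorm x ^- 2 * (p - q)) + (pnorm x)^-1 * 1 =
  (pnorm x - x * (p - q)) / pnorm x ^+ 2 by field.
have -> : pnorm x - x * (p - q) = q by rewrite -pq; ring.
by rewrite exprVn.
Qed.

Lemma is_derive_bcoord x :
  is_derive x 1 bcoord (- (acoord x ^+ n.-1 * (acoord x + bcoord x) ^+ 2)).
Proof.
have dN := is_derive_pnorm x; have dNV := is_derive_inv (pnorm_neq0 x) dN.
have dx := is_derive_sub (is_derive_const 1 x) (is_derive_var x).
apply: (is_derive_eq (is_derive_mul dx dNV)).
have := coordXpredD x; rewrite coordD.
set p := acoord x ^+ _; set q := bcoord x ^+ _.
rewrite /acoord /bcoord; have N0 := pnorm_neq0 x => pq.
have {}pq : x * p + (1 - x) * q = pnorm x.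
  by transitivity (pnorm x * (x / pnorm x * p + (1 - x) / pnorm x * q));
    [field | rewrite pq mulr1].
have -> : (1 - x) * (- pnorm x ^- 2 * (p - q)) + (pnorm x)^-1 * (0 - 1) =
  - (pnorm x + (1 - x) * (p - q)) / pnorm x ^+ 2 by field.
have -> : pnorm x + (1 - x) * (p - q) = p by rewrite -pq; ring.
by rewrite mulNr exprVn.
Qed.

Lemma continuous_pnorm : continuous pnorm.
Proof. exact: is_derive_continuous is_derive_pnorm. Qed.

Lemma continuous_acoord : continuous acoord.
Proof. exact: is_derive_continuous is_derive_acoord. Qed.

Lemma continuous_bcoord : continuous bcoord.
Proof. exact: is_derive_continuous is_derive_bcoord. Qed.

Lemma pnorm0 : pnorm 0 = 1.
Proof. by rewrite /pnorm expr0n eqn0Ngt n_gt0 subr0 expr1n add0r powR1. Qed.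

Lemma pnorm1 : pnorm 1 = 1.
Proof. by rewrite /pnorm subrr expr0n eqn0Ngt n_gt0 expr1n addr0 powR1. Qed.

Lemma acoord0 : acoord 0 = 0. Proof. exact: mul0r. Qed.
Lemma acoord1 : acoord 1 = 1. Proof. by rewrite /acoord pnorm1 divr1. Qed.
Lemma bcoord0 : bcoord 0 = 1.
Proof. by rewrite /bcoord pnorm0 divr1 subr0. Qed.
Lemma bcoord1 : bcoord 1 = 0. Proof. by rewrite /bcoord subrr mul0r. Qed.

Lemma acoord_itv x : 0 <= x <= 1 -> 0 <= acoord x <= 1.
Proof.
move=> /andP[x0 x1]; have N0 := pnorm_gt0 x.
have a0 : 0 <= acoord x by apply: divr_ge0; [|exact: ltW].
have b0 : 0 <= bcoord x by apply: divr_ge0; [rewrite subr_ge0 | exact: ltW].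
rewrite a0 -(@expr_le1 _ n) // -(coordXnD x) lerDl.
exact: exprn_ge0.
Qed.

Lemma bcoord_itv x : 0 <= x <= 1 -> 0 <= bcoord x <= 1.
Proof.
move=> /andP[x0 x1]; have N0 := pnorm_gt0 x.
have a0 : 0 <= acoord x by apply: divr_ge0; [|exact: ltW].
have b0 : 0 <= bcoord x by apply: divr_ge0; [rewrite subr_ge0 | exact: ltW].
rewrite b0 -(@expr_le1 _ n) // -(coordXnD x) lerDr.
exact: exprn_ge0.
Qed.

(** With u = a^n, the function (x + u - 1) N / 2, where N is the n-norm, has
    derivative N + ((n - 1) / 2) (a b)^(n-1) (a + b) and goes from - 1/2 to 1/2.
    In the variable u this says that
    I(n) = 1 - ((1 - 1/n) / 2) int_0^1 du / (u^(1/n) + (1 - u)^(1/n)):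
    the integrand no longer contains a power of a sum. *)
Lemma int_I_coord : int_I R n = 1 - n.-1%:R / 2 *
  int01 (fun x => (acoord x * bcoord x) ^+ n.-1 * (acoord x + bcoord x)).
Proof.
rewrite -[int_I R n]/(int01 pnorm).
have cN := continuous_pnorm; have ca := continuous_acoord.
have cb := continuous_bcoord.
pose f x := (acoord x * bcoord x) ^+ n.-1 * (acoord x + bcoord x).
have cf : continuous f by rewrite /f; solve_continuous.
rewrite -/f -int01Z //; apply/eqP; rewrite -subr_eq opprK; apply/eqP.
rewrite -int01D //; last by solve_continuous.
pose F x := 2^-1 * ((x + acoord x ^+ n - 1) * pnorm x).
suff dF x : is_derive x 1 F (pnorm x + n.-1%:R / 2 * f x).
  rewrite (int01_FTC _ dF); last by solve_continuous.
  rewrite /F acoord1 acoord0 pnorm0 pnorm1 expr1n expr0n eqn0Ngt n_gt0.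
  by rewrite /=; field.
have dN := is_derive_pnorm x; have da := is_derive_acoord x.
rewrite /F; apply: is_derive_eq; first by solve_derive.
rewrite /= /f (exprMn n.-1 (acoord x) (bcoord x)) scaler0.
have := coordXpredD x; have := coordD x.
have -> : acoord x ^+ n = acoord x * acoord x ^+ n.-1 by rewrite -exprS prednK.
have -> : n%:R = n.-1%:R + 1 :> R by rewrite natr1 prednK.
set m : R := n.-1%:R.
have xa : x = acoord x * pnorm x by rewrite divfK.
set p := acoord x ^+ _; set q := bcoord x ^+ _.
have N0 := pnorm_neq0 x; move: (pnorm x) N0 xa => N N0 xa.
move: (acoord x) (bcoord x) xa => a b -> ab pq.
have {}ab : a = N^-1 - b by rewrite -ab addrK.
transitivity (N + m / 2 * (p * q * (a + b)) +
  (a * p + b * q - 1) * (N + p) / 2); last by rewrite pq subrr !mul0r addr0.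
by rewrite ab; field.
Qed.

(** In the variable u = a^n, of differential n (a b)^(n-1) (a + b)^2 dx, this is
    B((k + 1) / n, (l + 1) / n) / n, where B is Euler's Beta function. *)
Definition coord_moment k l : R :=
  int01 (fun x => acoord x ^+ k * bcoord x ^+ l * (acoord x + bcoord x) ^+ 2).

Let ca := continuous_acoord.
Let cb := continuous_bcoord.

Let monomial_cont k l : continuous
  (fun x => acoord x ^+ k * bcoord x ^+ l * (acoord x + bcoord x) ^+ 2).
Proof. have := (ca, cb) => -[? ?]; solve_continuous. Qed.

(** The Beta recurrence p B(p, q) = (p + q) B(p + 1, q), obtained by integrating
    the derivative of a^(k+1) b^(l+1), which vanishes at both ends. *)
Lemma coord_moment_addn k l :
  (k + l + 2)%:R * coord_moment (k + n) l = (k + 1)%:R * coord_moment k l.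
Proof.
have ca' := ca; have cb' := cb.
pose F x := acoord x ^+ k.+1 * bcoord x ^+ l.+1.
pose f i x := acoord x ^+ i * bcoord x ^+ l * (acoord x + bcoord x) ^+ 2.
apply/esym/eqP; rewrite -subr_eq0 -!int01Z //; apply/eqP.
rewrite -int01B; [|solve_continuous..].
suff dF x : is_derive x 1 F
    ((k + 1)%:R * f k x - (k + l + 2)%:R * f (k + n)%N x).
  rewrite (int01_FTC _ dF); last by rewrite /f; solve_continuous.
  by rewrite /F acoord0 bcoord1 !expr0n /= !mul0r mulr0 subrr.
have da := is_derive_acoord x; have db := is_derive_bcoord x.
rewrite /F; apply: is_derive_eq; first by solve_derive.
rewrite /= /f exprD.
have -> : acoord x ^+ n = acoord x * acoord x ^+ n.-1 by rewrite -exprS prednK.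
rewrite [acoord x ^+ k.+1]exprS [bcoord x ^+ l.+1]exprS !natrD -!natr1.
move: (acoord x) (bcoord x) (coordXpredD x) => a b.
set p := a ^+ _; set q := b ^+ _ => pq.
have bq : b * q = 1 - a * p by rewrite -pq addrC addKr.
transitivity ((b * q) * ((k%:R + 1) * a ^+ k * b ^+ l * (a + b) ^+ 2)
  - (l%:R + 1) * a ^+ k * b ^+ l * (a * p) * (a + b) ^+ 2); first by ring.
by rewrite bq; ring.
Qed.

(** This is B(1, q) = 1 / q. *)
Lemma coord_moment_predn l : coord_moment n.-1 l = l.+1%:R^-1.
Proof.
have ca' := ca; have cb' := cb.
pose F x : R := - l.+1%:R^-1 * bcoord x ^+ l.+1.
pose f x := acoord x ^+ n.-1 * bcoord x ^+ l * (acoord x + bcoord x) ^+ 2.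
suff dF x : is_derive x 1 F (f x).
  rewrite /coord_moment (int01_FTC _ dF); last exact: monomial_cont.
  rewrite /F bcoord0 bcoord1.
  by rewrite expr0n expr1n /= mulr0 mulr1 sub0r opprK.
have db := is_derive_bcoord x.
rewrite /F; apply: is_derive_eq; first by solve_derive.
have l0 : l.+1%:R != 0 :> R by rewrite pnatr_eq0.
by rewrite /= /f mulr0 addr0; field; rewrite addrC natr1.
Qed.

Lemma le_coord_moment k k' l : (k <= k')%N ->
  coord_moment k' l <= coord_moment k l.
Proof.
move=> kk'; apply: le_int01 => // x x01.
have /andP[a0 a1] := acoord_itv x01; have /andP[b0 b1] := bcoord_itv x01.
apply: ler_wpM2r; first exact/exprn_ge0/addr_ge0.
apply: ler_wpM2r; first exact/exprn_ge0.
exact: ler_wiXn2l.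
Qed.

End SuperellipseCurve.

(** * Beta integrals as infinite products *)

Section GammaProduct.
Context {R : realType}.
Implicit Types x y : R.

Definition gamma_factor x y (s : nat) : R :=
  s.+1%:R * (s.+1%:R + x + y) / ((s.+1%:R + x) * (s.+1%:R + y)).

(** The partial products of
    Gamma (1 + x) Gamma (1 + y) / Gamma (1 + x + y). *)
Definition gamma_product x y (m : nat) : R := \prod_(s < m) gamma_factor x y s.

Lemma cvg_shift_ratio (c d : R) :
  (m%:R + c) / (m%:R + d) @[m --> \oo] --> (1 : R).
Proof.
have inv0 : (m%:R : R)^-1 @[m --> \oo] --> (0 : R).
  by rewrite -cvg_shiftS /=; exact: cvg_harmonic.
have lim_num (e : R) : 1 + e * (m%:R)^-1 @[m --> \oo] --> (1 : R).
  rewrite -[X in _ --> X]addr0; apply: cvgD; first exact: cvg_cst.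
  by rewrite -[X in _ --> X](mulr0 e); apply: cvgM => //; exact: cvg_cst.
have lim1 : (1 + c * (m%:R)^-1) / (1 + d * (m%:R)^-1) @[m --> \oo] --> (1 : R).
  rewrite -[X in _ --> X]mulr1 -[X in _ * X]invr1.
  by apply: cvgM => //; apply: cvgV => //; exact: oner_neq0.
apply: cvg_trans lim1; apply: near_eq_cvg; near=> m.
have m0 : m%:R != 0 :> R.
  by rewrite pnatr_eq0 -lt0n; near: m; exact: nbhs_infty_gt.
have ratioE e : 1 + e * (m%:R)^-1 = (m%:R + e) / m%:R :> R.
  by rewrite mulrDl mulfV.
by rewrite !ratioE invf_div mulrA divfK.
Unshelve. all: by end_near. Qed.

End GammaProduct.

Section MomentProduct.
Context {R : realType} (n k l : nat).
Context (n_gt0 : (0 < n)%N) (k_lt : (k < n.*2)%N) (kl_gt : (n < k + l + 2)%N).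

Let x : R := (k.+1%:R - n%:R) / n%:R.
Let y : R := (l.+1%:R - n%:R) / n%:R.
Let E i : R := coord_moment n i l.

Let n0 : n%:R != 0 :> R.
Proof. by rewrite pnatr_eq0 -lt0n. Qed.

Lemma coord_moment_gt0 m : 0 < E (n.-1 + m * n).
Proof.
elim: m => [|m IH]; first by rewrite addn0 /E coord_moment_predn.
have := coord_moment_addn n_gt0 (n.-1 + m * n) l (R := R).
rewrite -(addnA _ _ n) -mulSnr => rec.
have : 0 < (n.-1 + m * n + l + 2)%:R * E (n.-1 + m.+1 * n).
  by rewrite rec mulr_gt0 // ltr0n addn1.
by rewrite pmulr_rgt0 // ltr0n addn2.
Qed.

Let k_gt0 m : 0 < E (k + m * n).
Proof.
apply: lt_le_trans (coord_moment_gt0 m.+1) _; apply: le_coord_moment => //.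
by move: k_lt; rewrite mulSnr; case: n n_gt0 => // n' _; lia.
Qed.

Let nx : n%:R * x = k%:R + 1 - n%:R.
Proof. by rewrite mulrC divfK // -natr1. Qed.

Let ny : n%:R * y = l%:R + 1 - n%:R.
Proof. by rewrite mulrC divfK // -natr1. Qed.

Let x1_gt0 : 0 < 1 + x.
Proof.
by rewrite -(pmulr_rgt0 _ (x := n%:R)) ?ltr0n // mulrDr nx mulr1 addrC subrK natr1.
Qed.

Let y1_gt0 : 0 < 1 + y.
Proof.
by rewrite -(pmulr_rgt0 _ (x := n%:R)) ?ltr0n // mulrDr ny mulr1 addrC subrK natr1.
Qed.

(* The recurrence in the first index, along k + m n and along n - 1 + m n, both
   divided by n. *)
Let k_rec m : (m%:R + 2 + x + y) * E (k + m.+1 * n) =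
  (m%:R + 1 + x) * E (k + m * n).
Proof.
have := coord_moment_addn n_gt0 (k + m * n) l (R := R).
rewrite -(addnA _ _ n) -mulSnr -/(E _) -/(E _) => rec.
apply: (mulfI n0); rewrite !mulrA.
transitivity ((k + m * n + l + 2)%:R * E (k + m.+1 * n)).
  congr (_ * _); rewrite !mulrDr nx ny !natrD natrM; ring.
rewrite rec; congr (_ * _); rewrite !mulrDr nx !natrD natrM; ring.
Qed.

Let pred_rec m : (m%:R + 2 + y) * E (n.-1 + m.+1 * n) =
  (m%:R + 1) * E (n.-1 + m * n).
Proof.
have := coord_moment_addn n_gt0 (n.-1 + m * n) l (R := R).
rewrite -(addnA _ _ n) -mulSnr -/(E _) -/(E _) => rec.
have predn : n%:R = n.-1%:R + 1 :> R by rewrite natr1 prednK.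
apply: (mulfI n0); rewrite !mulrA.
transitivity ((n.-1 + m * n + l + 2)%:R * E (n.-1 + m.+1 * n)).
  congr (_ * _); rewrite !mulrDr ny !natrD natrM predn; ring.
rewrite rec; congr (_ * _); rewrite !natrD natrM predn; ring.
Qed.

(** Both sides satisfy the same first-order recurrence in m. *)
Lemma gamma_product_moment m :
  gamma_product x y m * E (k + m * n) * (m%:R + (1 + x + y)) =
  ((k + l + 2)%:R - n%:R) * E k * E (n.-1 + m * n) * (m%:R + (1 + y)).
Proof.
elim: m => [|m IH].
  rewrite /gamma_product big_ord0 !mul0n !addn0 [E n.-1]/E coord_moment_predn //.
  have l0 : l%:R + 1 != 0 :> R by rewrite natr1 pnatr_eq0.
  by rewrite /x /y -!natr1 !natrD; field; apply/andP.
rewrite /gamma_product big_ord_recr /= -/(gamma_product x y m) /gamma_factor.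
have mx : m%:R + 1 + x != 0 by rewrite -addrA gt_eqF // ltr_wpDl.
have my : m%:R + 1 + y != 0 by rewrite -addrA gt_eqF // ltr_wpDl.
rewrite -natr1.
transitivity (gamma_product x y m * (m%:R + 1) * (m%:R + 1 + x + y) /
  ((m%:R + 1 + x) * (m%:R + 1 + y)) *
  ((m%:R + 2 + x + y) * E (k + m.+1 * n))); first by ring.
transitivity (((k + l + 2)%:R - n%:R) * E k *
  ((m%:R + 2 + y) * E (n.-1 + m.+1 * n))); last by ring.
rewrite k_rec pred_rec.
transitivity ((m%:R + 1) / (m%:R + 1 + y) *
 (gamma_product x y m * E (k + m * n) * (m%:R + (1 + x + y)))).
  by field; apply/andP.
by rewrite IH; field.
Qed.

(* E is nonincreasing and k + m n lies between n - 1 + (m - 1) n and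
   n - 1 + (m + 1) n, whose moments have ratios to that of n - 1 + m n which
   tend to one. *)
Let cvg_ratio : E (n.-1 + m * n) / E (k + m * n) @[m --> \oo] --> (1 : R).
Proof.
have Zgt := coord_moment_gt0.
apply: (@squeeze_cvgr _ _ _ _ (fun m => (m%:R + 0) / (m%:R + (1 + y)))
   (fun m => (m%:R + (2 + y)) / (m%:R + 1))); last 2 first.
- exact: cvg_shift_ratio.
- exact: cvg_shift_ratio.
apply: nearW => m; apply/andP; split.
- case: m => [|m]; first by rewrite add0r mul0r divr_ge0 ?ltW.
  rewrite ler_pdivlMr // mulrAC ler_pdivrMr; last first.
    by rewrite ltr_wpDl.
  have := pred_rec m; rewrite addr0 -(natr1 m).
  have -> : m%:R + 1 + (1 + y) = m%:R + 2 + y by ring.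
  move=> Zrec; rewrite [leRHS]mulrC Zrec.
  apply: ler_wpM2l; first by rewrite addr_ge0.
  apply: le_coord_moment => //; rewrite mulSnr.
  by case: n n_gt0 => // n' _; lia.
- rewrite ler_pdivrMr // mulrAC ler_pdivlMr; last by rewrite ltr_wpDl.
  rewrite mulrC addrA -pred_rec.
  apply: ler_wpM2l.
    by rewrite -addrA addr_ge0 // (natrD _ 1 1) -addrA addr_ge0 // ltW.
  apply: le_coord_moment => //; rewrite mulSnr.
  by move: k_lt; case: n n_gt0 => // n' _; lia.
Qed.

(** This is the product formula for (1 + x + y) B(1 + x, 1 + y).  The reference
    moments of index n - 1 + m n play the role of the usual asymptotics of the
    Gamma function: they are explicit, and the shift by k has no influence on
    their size in the limit. *)
Lemma cvg_gamma_product_moment :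
  gamma_product x y m @[m --> \oo] --> ((k + l + 2)%:R - n%:R) * E k.
Proof.
have xy_gt0 : 0 < 1 + x + y.
  rewrite -(pmulr_rgt0 _ (x := n%:R)) ?ltr0n // !mulrDr nx ny.
  have -> : n%:R * 1 + (k%:R + 1 - n%:R) + (l%:R + 1 - n%:R) =
    (k + l + 2)%:R - n%:R :> R by rewrite !natrD; ring.
  by rewrite subr_gt0 ltr_nat.
have -> : gamma_product x y = fun m => ((k + l + 2)%:R - n%:R) * E k *
   ((E (n.-1 + m * n) / E (k + m * n)) *
    ((m%:R + (1 + y)) / (m%:R + (1 + x + y)))).
  apply/funext => m; have E0 : E (k + m * n) != 0 by rewrite gt_eqF.
  have m0 : m%:R + (1 + x + y) != 0 by rewrite gt_eqF // ltr_wpDl.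
  apply: (mulIf E0); apply: (mulIf m0); rewrite gamma_product_moment.
  by field; rewrite E0 -!addrA; move: m0; rewrite -!addrA => ->.
rewrite -[X in _ --> X]mulr1; apply: cvgM; first exact: cvg_cst.
rewrite -[X in _ --> X]mulr1; apply: cvgM; first exact: cvg_ratio.
exact: cvg_shift_ratio.
Qed.

End MomentProduct.

(** * Replacing 1 / (a + b) by a form with rational coefficients *)

Section RationalForms.
Context {R : realType}.
Implicit Types (f g : R -> R -> R) (d : nat).

(** Homogeneous polynomials of degree d in two variables, over the rationals. *)
Definition rat_form d f := exists c : nat -> rat, forall a b : R,
  f a b = \sum_(i < d.+1) ratr (c i) * (a ^+ i * b ^+ (d - i)).

Lemma rat_formD d f g : rat_form d f -> rat_form d g ->
  rat_form d (fun a b => f a b + g a b).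
Proof.
move=> [c fE] [e gE]; exists (fun i => c i + e i) => a b.
rewrite fE gE -big_split /=; apply: eq_bigr => i _.
by rewrite rmorphD mulrDl.
Qed.

Lemma rat_formZ d f (q : rat) : rat_form d f ->
  rat_form d (fun a b => ratr q * f a b).
Proof.
move=> [c fE]; exists (fun i => q * c i) => a b.
rewrite fE mulr_sumr; apply: eq_bigr => i _.
by rewrite rmorphM mulrA.
Qed.

Lemma rat_form_cst (q : rat) : rat_form 0 (fun _ _ => ratr q).
Proof. by exists (fun=> q) => a b; rewrite big_ord1 !expr0 !mulr1. Qed.

Lemma rat_form_mull d f : rat_form d f -> rat_form d.+1 (fun a b => a * f a b).
Proof.
move=> [c fE]; exists (fun i => if i is j.+1 then c j else 0) => a b.
rewrite big_ord_recl /= rmorph0 mul0r add0r fE mulr_sumr.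
by apply: eq_bigr => i _; rewrite exprS subSS; ring.
Qed.

Lemma rat_form_mulr d f : rat_form d f -> rat_form d.+1 (fun a b => b * f a b).
Proof.
move=> [c fE]; exists (fun i => if (i <= d)%N then c i else 0) => a b.
rewrite big_ord_recr /= ltnn rmorph0 mul0r addr0 fE mulr_sumr.
apply: eq_bigr => i _; have id := ltn_ord i.
by rewrite -ltnS id subSn // exprS; ring.
Qed.

Lemma rat_form0 d : rat_form d (fun _ _ => 0).
Proof.
by exists (fun=> 0) => a b; rewrite big1 // => i _; rewrite rmorph0 mul0r.
Qed.

Lemma rat_form_sum d k (F : nat -> R -> R -> R) :
  (forall j, (j < k)%N -> rat_form d (F j)) ->
  rat_form d (fun a b => \sum_(j < k) F j a b).
Proof.
elim: k => [|k IH] FE.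
  by have [c cE] := rat_form0 d; exists c => a b; rewrite big_ord0 -cE.
have [|c cE] := rat_formD (IH _) (FE k (ltnSn _)).
  by move=> j jk; apply: FE; rewrite ltnS ltnW.
by exists c => a b; rewrite big_ord_recr -cE.
Qed.

Lemma eq_rat_form d f g : f =2 g -> rat_form d f -> rat_form d g.
Proof. by move=> fg [c fE]; exists c => a b; rewrite -fg. Qed.

Lemma rat_form_mul_prod p d f : rat_form d f ->
  rat_form (d + p.*2) (fun a b => (a * b) ^+ p * f a b).
Proof.
move=> fd; elim: p => [|p IH].
  by rewrite addn0; apply: eq_rat_form fd => a b; rewrite mul1r.
rewrite doubleS !addnS; apply: eq_rat_form (rat_form_mull (rat_form_mulr IH)).
by move=> a b; rewrite exprS; ring.
Qed.

Lemma rat_form_mul_gap p d f : rat_form d f ->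
  rat_form (d + p.*2) (fun a b => (- ((a - b) ^+ 2 / 4)) ^+ p * f a b).
Proof.
move=> fd; elim: p => [|p IH].
  by rewrite addn0; apply: eq_rat_form fd => a b; rewrite mul1r.
rewrite doubleS !addnS.
have sub h e : rat_form e h -> rat_form e.+1 (fun a b => (a - b) * h a b).
  move=> he.
  apply: eq_rat_form (rat_formD (rat_form_mull he)
    (rat_formZ (-1) (rat_form_mulr he))) => a b.
  by rewrite rmorphN1; ring.
apply: eq_rat_form (rat_formZ (- 4^-1) (sub _ _ (sub _ _ IH))) => a b.
rewrite rmorphN fmorphV rmorph_nat /= (exprS _ p).
by move: (_ ^+ p) => t; ring.
Qed.

(** Dividing by (a b)^(M+1) (a + b), this is the expansion of 1 / (a + b) as a
    truncated geometric series in the ratio - (a - b)^2 / (4 a b), based on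
    a b + (a - b)^2 / 4 = (a + b)^2 / 4.  The ratio is small because a and b are
    n-th roots, hence close to 1. *)
Lemma geometric_split M : exists P, rat_form M.*2.+1 P /\ forall a b,
  (a * b) ^+ M.+1 = (a + b) * P a b + (- ((a - b) ^+ 2 / 4)) ^+ M.+1.
Proof.
pose F j (a b : R) := (- ((a - b) ^+ 2 / 4)) ^+ j * ((a * b) ^+ (M - j) *
  (a * 4^-1 + b * 4^-1)).
exists (fun a b => \sum_(j < M.+1) F j a b); split.
  apply: rat_form_sum => j; rewrite ltnS => jM.
  have -> : M.*2.+1 = (1 + (M - j).*2 + j.*2)%N.
    by rewrite -addnA -doubleD subnK.
  apply/rat_form_mul_gap/rat_form_mul_prod.
  have -> : 4^-1 = ratr 4^-1 :> R by rewrite fmorphV rmorph_nat.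
  by apply: rat_formD; [apply: rat_form_mull | apply: rat_form_mulr];
    exact: rat_form_cst.
move=> a b; apply/eqP; rewrite -subr_eq subrXX; apply/eqP.
have -> : a * b - - ((a - b) ^+ 2 / 4) = (a + b) * (a * 4^-1 + b * 4^-1) by field.
rewrite -mulrA; congr (_ * _); rewrite mulr_sumr; apply: eq_bigr => j _.
by rewrite /F /=; ring.
Qed.

(** For b <= a the left-hand side is at most m (1 - b) b^m, and the sum of the
    b^s for s < m is at least m b^m.  So a power of a b, whose exponent m is a
    small proportion of n, turns the gap a - b into a factor 1 / m. *)
Lemma gap_mul_prod_exp (a b : R) m : 0 <= a <= 1 -> 0 <= b <= 1 ->
  m%:R * (`|a - b| * (a * b) ^+ m) <= 1.
Proof.
wlog ba : a b / b <= a => [hw a01 b01|].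
  have [ba|/ltW ab] := leP b a; first exact: hw.
  by rewrite distrC [a * b]mulrC; exact: hw.
move=> /andP[a0 a1] /andP[b0 b1]; rewrite ger0_norm ?subr_ge0 //.
have geo : m%:R * ((1 - b) * b ^+ m) <= 1.
  apply: (@le_trans _ _ (1 - b ^+ m)); last by rewrite lerBlDr lerDl exprn_ge0.
  rewrite -[X in _ <= X - _](expr1n _ m) subrXX mulrCA; apply: ler_wpM2l.
    by rewrite subr_ge0.
  rewrite -[m in m%:R]card_ord -sumr_const mulr_suml; apply: ler_sum => i _.
  rewrite mul1r expr1n mul1r; apply: ler_wiXn2l => //; exact: ltnW.
apply: le_trans geo; apply: ler_wpM2l => //; rewrite exprMn.
apply: ler_pM; rewrite ?subr_ge0 ?mulr_ge0 ?exprn_ge0 //; first by rewrite lerB.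
by rewrite ler_piMl ?exprn_ge0 // exprn_ile1.
Qed.

Lemma continuous_sum k (F : nat -> R -> R) : (forall i, continuous (F i)) ->
  continuous (fun x => \sum_(i < k) F i x).
Proof.
move=> cF; elim: k => [|k IH].
  by under [X in continuous X]eq_fun do rewrite big_ord0; exact: continuous_const.
by under [X in continuous X]eq_fun do rewrite big_ord_recr; exact: continuous_add.
Qed.

Lemma int01_sum k (F : nat -> R -> R) : (forall i, continuous (F i)) ->
  int01 (fun x => \sum_(i < k) F i x) = \sum_(i < k) int01 (F i).
Proof.
move=> cF; have cS j := @continuous_sum j _ cF.
elim: k => [|k IH].
  rewrite big_ord0 -[RHS](int01_cst 0); apply: eq_int01 => x _; exact: big_ord0.
rewrite big_ord_recr /= -IH -int01D //; apply: eq_int01 => x _.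
by rewrite big_ord_recr.
Qed.

End RationalForms.

(** * The integral as a rational combination of Beta integrals *)

Section MomentExpansion.
Context {R : realType}.

Lemma gap_remainder (n M m : nat) : (0 < n)%N -> (0 < m)%N ->
  ((M * m).*2 + M <= n.-1)%N ->
  `|int01 (fun x : R => (acoord n x * bcoord n x) ^+ (n.-1 - M) *
      (acoord n x + bcoord n x) *
      (- ((acoord n x - bcoord n x) ^+ 2 / 4)) ^+ M)| <= 2 * m%:R ^- M.*2.
Proof.
move=> n0 m0 nM; have ca := @continuous_acoord R _ n0.
have cb := @continuous_bcoord R _ n0.
set h := (X in int01 X); have ch : continuous h.
  have -> : h = fun x => (acoord n x * bcoord n x) ^+ (n.-1 - M) *
      (acoord n x + bcoord n x) *
      (0 - ((acoord n x - bcoord n x) ^+ 2 * 4^-1)) ^+ M.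
    by apply/funext => x; rewrite sub0r.
  by solve_continuous.
pose B : R := 2 * m%:R ^- M.*2.
have hB x : 0 <= x <= 1 -> `|h x| <= B.
  move=> x01; have a01 := acoord_itv n0 x01; have b01 := bcoord_itv n0 x01.
  have gap := gap_mul_prod_exp m a01 b01; rewrite /h.
  case/andP: a01 b01 gap => + + /andP[].
  move: (acoord n x) (bcoord n x) => a b a0 a1 b0 b1 gap.
  have ab0 : 0 <= a * b by rewrite mulr_ge0.
  have ab1 : a * b <= 1 by rewrite mulr_ile1.
  rewrite 2!normrM [`|(a * b) ^+ _|]ger0_norm ?exprn_ge0 //.
  rewrite [`|_ + _|]ger0_norm ?addr_ge0 //.
  rewrite normrX normrN normrM normrX normfV normr_nat.
  set t := `|a - b|.
  have -> : (t ^+ 2 / 4) ^+ M = 4 ^- M * t ^+ M.*2.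
    by rewrite exprMn exprVn -exprM mul2n mulrC.
  have powab : (a * b) ^+ (n.-1 - M) <= (a * b) ^+ (m * M.*2).
    apply: ler_wiXn2l => //; rewrite leq_subRL.
      by rewrite -doubleMr mulnC addnC.
    by rewrite (leq_trans _ nM) // leq_addl.
  have gapM : t ^+ M.*2 * (a * b) ^+ (m * M.*2) <= m%:R ^- M.*2.
    rewrite exprM -exprMn -exprVn; apply: lerXn2r.
    - by rewrite nnegrE mulr_ge0 ?exprn_ge0 ?normr_ge0.
    - by rewrite nnegrE invr_ge0.
    - by rewrite -[leRHS]mul1r ler_pdivlMr ?ltr0n // mulrC.
  have inv4 : 4 ^- M <= 1 :> R.
    by rewrite -exprVn exprn_ile1 ?invr_ge0 // invf_le1 // ler1n.
  have t0 : 0 <= t ^+ M.*2 by rewrite exprn_ge0 ?normr_ge0.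
  apply: (@le_trans _ _ ((a * b) ^+ (m * M.*2) * 2 * (1 * t ^+ M.*2))).
    apply: ler_pM.
    - by rewrite mulr_ge0 ?exprn_ge0 ?addr_ge0.
    - by rewrite mulr_ge0 // invr_ge0 exprn_ge0.
    - by apply: ler_pM; rewrite ?exprn_ge0 ?addr_ge0 //; lra.
    - exact: ler_wpM2r.
  by rewrite /B mul1r -mulrA mulrCA ler_wpM2l // mulrC.
have cB := @continuous_const R B.
rewrite -/B ler_norml; apply/andP; split.
  rewrite -(int01_cst (- B)); apply: le_int01 => //; first exact: continuous_const.
  by move=> x /hB; rewrite ler_norml => /andP[].
rewrite -(int01_cst B); apply: le_int01 => //.
by move=> x /hB; rewrite ler_norml => /andP[].
Qed.

(** The coefficients do not depend on n, so the asymptotics of the integral is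
    reduced to that of finitely many moments.  The parameter m is meant to be a
    fixed proportion of n. *)
Lemma coord_integral_expansion M : exists c : nat -> rat, forall n m : nat,
  (0 < n)%N -> (0 < m)%N -> ((M.+1 * m).*2 + M.+1 <= n.-1)%N ->
  `|int01 (fun x : R => (acoord n x * bcoord n x) ^+ n.-1 *
       (acoord n x + bcoord n x)) -
    \sum_(i < M.*2.+2) ratr (c i) *
      @coord_moment R n (i + (n.-1 - M.+1)) (M.*2.+1 - i + (n.-1 - M.+1))|
  <= 2 * m%:R ^- M.+1.*2.
Proof.
have [P [[c PE] splitE]] := @geometric_split R M.
exists c => n m n0 m0 nM.
have ca := @continuous_acoord R _ n0; have cb := @continuous_bcoord R _ n0.
apply: (le_trans _ (gap_remainder n0 m0 nM)).
rewrite le_eqVlt; apply/predU1P; left; congr `|_|.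
pose F i x : R := ratr (c i) * (acoord n x ^+ (i + (n.-1 - M.+1)) *
   bcoord n x ^+ (M.*2.+1 - i + (n.-1 - M.+1)) * (acoord n x + bcoord n x) ^+ 2).
have cF i : continuous (F i) by rewrite /F; solve_continuous.
transitivity (int01 (fun x : R => (acoord n x * bcoord n x) ^+ n.-1 *
       (acoord n x + bcoord n x)) - int01 (fun x => \sum_(i < M.*2.+2) F i x)).
  rewrite int01_sum //; congr (_ - _); apply: eq_bigr => i _.
  by rewrite /F int01Z //; solve_continuous.
rewrite -int01B; last 2 first.
- by solve_continuous.
- exact: continuous_sum.
apply: eq_int01 => x _; rewrite /F.
move: (acoord n x) (bcoord n x) => a b.
have M_le : (M.+1 <= n.-1)%N by rewrite (leq_trans _ nM) // leq_addl.
rewrite -[in (a * b) ^+ n.-1](subnK M_le); set N := (n.-1 - M.+1)%N.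
have -> : \sum_(i < M.*2.+2) ratr (c i) *
    (a ^+ (i + N) * b ^+ (M.*2.+1 - i + N) * (a + b) ^+ 2) =
    (a * b) ^+ N * (a + b) ^+ 2 * P a b.
  rewrite PE mulr_sumr; apply: eq_bigr => i _.
  by rewrite !exprD exprMn; ring.
by rewrite exprD splitE; ring.
Qed.

End MomentExpansion.

(** * Taylor bounds for the logarithm and the exponential *)

Section TaylorBounds.
Context {R : realType}.
Implicit Types (f df : R -> R) (x y z : R).

Lemma le_exp_of_derive f df (r C : R) (N : nat) : 0 <= C -> f 0 = 0 ->
  (forall t : R, `|t| <= r -> is_derive t 1 f (df t)) ->
  (forall t, `|t| <= r -> `|df t| <= C * `|t| ^+ N) ->
  forall z, `|z| <= r -> `|f z| <= C * `|z| ^+ N.+1.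
Proof.
move=> C0 f0 fd dfC z zr.
have cf (a b : R) : (forall t, t \in `[a, b] -> `|t| <= r) ->
    {within `[a, b], continuous f}.
  move=> tr; apply: derivable_within_continuous => t /tr /fd ?.
  exact: ex_derive.
have bound c : `|c| <= `|z| -> `|df c * z| <= C * `|z| ^+ N.+1.
  move=> cz; rewrite normrM exprSr mulrA ler_wpM2r ?normr_ge0 //.
  apply: (le_trans (dfC _ (le_trans cz zr))); apply: ler_wpM2l => //.
  by apply: lerXn2r => //; rewrite nnegrE.
have [z0|z0|->] := ltgtP z 0.
- have [c||c + fE] := @MVT R f df z 0 z0.
  + rewrite in_itv /= => /andP[zc c0]; apply: fd; apply: le_trans zr.
    by rewrite !ltr0_norm // lerN2 ltW.
  + apply: cf => t; rewrite in_itv /= => /andP[zt t0]; apply: le_trans zr.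
    by rewrite ler0_norm // ltr0_norm // lerN2.
  + rewrite in_itv /= => /andP[zc c0].
    move: fE; rewrite f0 !sub0r mulrN => /oppr_inj ->; apply: bound.
    by rewrite !ltr0_norm // lerN2 ltW.
- have [c||c + fE] := @MVT R f df 0 z z0.
  + rewrite in_itv /= => /andP[c0 cz]; apply: fd; apply: le_trans zr.
    by rewrite !gtr0_norm // ltW.
  + apply: cf => t; rewrite in_itv /= => /andP[t0 tz]; apply: le_trans zr.
    by rewrite ger0_norm // gtr0_norm.
  + rewrite in_itv /= => /andP[c0 cz].
    move: fE; rewrite f0 !subr0 => ->; apply: bound.
    by rewrite !gtr0_norm // ltW.
- by rewrite f0 normr0 expr0n mulr0.
Qed.

Lemma is_derive_sum_fun k (F dF : nat -> R -> R) x :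
  (forall i, is_derive x 1 (F i) (dF i x)) ->
  is_derive x 1 (fun y => \sum_(i < k) F i y) (\sum_(i < k) dF i x).
Proof.
move=> FE; elim: k => [|k IH].
  under eq_fun do rewrite big_ord0; rewrite big_ord0; exact: is_derive_const.
under eq_fun do rewrite big_ord_recr; rewrite big_ord_recr.
exact: is_derive_add.
Qed.

(** The Taylor polynomial of ln (1 + z) of degree N. *)
Definition ln1p_poly (N : nat) (z : R) : R :=
  \sum_(k < N) (-1) ^+ k / k.+1%:R * z ^+ k.+1.

Lemma ln1p_poly_bound N z : `|z| <= 2^-1 ->
  `|ln (1 + z) - ln1p_poly N z| <= 2 * `|z| ^+ N.+1.
Proof.
pose df (t : R) : R := (1 + t)^-1 - \sum_(k < N) (-1) ^+ k * t ^+ k.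
have half (t : R) : `|t| <= 2^-1 -> 2^-1 <= 1 + t.
  by rewrite ler_norml => /andP[]; lra.
apply: (@le_exp_of_derive (fun z => ln (1 + z) - ln1p_poly N z) df).
- by [].
- rewrite addr0 ln1 sub0r /ln1p_poly big1 ?oppr0 // => i _.
  by rewrite expr0n mulr0.
- move=> t th; have t1 : 0 < 1 + t by have := half t th; lra.
  rewrite /df; apply: is_derive_sub.
    have d1 := is_derive_add (is_derive_const 1 t) (is_derive_var t).
    have := @is_derive1_comp _ (@ln R) _ t _ _ (is_derive1_ln t1) d1.
    by move=> dl; apply: (is_derive_eq dl); rewrite add0r mulr1.
  rewrite /ln1p_poly.
  apply: (@is_derive_sum_fun _ (fun k z => (-1) ^+ k / k.+1%:R * z ^+ k.+1)
    (fun k z => (-1) ^+ k * z ^+ k)) => k.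
  have dt := is_derive_var t; apply: is_derive_eq; first by solve_derive.
  have k0 : k.+1%:R != 0 :> R by rewrite pnatr_eq0.
  by rewrite /= mulr0 addr0 mulr1 mulrA divfK.
- move=> t th; have t1 := half t th.
  have -> : df t = (- t) ^+ N / (1 + t).
    have t0 : 1 + t != 0 by rewrite gt_eqF //; lra.
    apply: (mulIf t0); rewrite divfK // mulrBl mulVf //.
    have -> : \sum_(k < N) (-1) ^+ k * t ^+ k = \sum_(k < N) (- t) ^+ k.
      by apply: eq_bigr => k _; rewrite -exprMn mulN1r.
    have := subrX1 (- t) N; rewrite -opprB -[- t - 1]opprD mulNr => /oppr_inj.
    by rewrite [t + 1]addrC mulrC => <-; rewrite opprB addrC subrK.
  rewrite normrM normrX normrN mulrC; apply: ler_wpM2r; first exact: exprn_ge0.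
  by rewrite normfV gtr0_norm; [rewrite invf_ple ?posrE; lra | lra].
Qed.

Definition exp_poly (N : nat) (z : R) : R := \sum_(k < N) z ^+ k / k`!%:R.

Lemma exp_poly_bound N z : `|z| <= 1 ->
  `|expR z - exp_poly N z| <= expR 1 * `|z| ^+ N.
Proof.
elim: N z => [|N IH] z z1.
  rewrite /exp_poly big_ord0 subr0 expr0 mulr1 ger0_norm ?expR_ge0 //.
  by rewrite ler_expR; move: z1; rewrite ler_norml => /andP[].
apply: (@le_exp_of_derive (fun z => expR z - exp_poly N.+1 z)
  (fun z => expR z - exp_poly N z) 1) => //.
  rewrite expR0 /exp_poly big_ord_recl big1 ?addr0.
    by rewrite expr0 fact0 divr1 subrr.
  by move=> i _; rewrite expr0n mul0r.
move=> t t1; apply: is_derive_sub.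
rewrite /exp_poly; under eq_fun do rewrite big_ord_recl.
apply: is_derive_eq.
  apply: is_derive_add; first by solve_derive.
  apply: (@is_derive_sum_fun _ (fun k z => z ^+ k.+1 / k.+1`!%:R)
    (fun k z => z ^+ k / k`!%:R)) => k.
  have dt := is_derive_var t; apply: is_derive_eq; first by solve_derive.
  have k0 : k.+1%:R != 0 :> R by rewrite pnatr_eq0.
  have kf : k`!%:R != 0 :> R by rewrite pnatr_eq0 -lt0n fact_gt0.
  rewrite /= factS natrM scaler0 mulr0 add0r mulr1.
  by field; apply/andP.
by rewrite /= scaler0 !mulr0 !add0r.
Qed.

End TaylorBounds.

(** * The logarithm of the Gamma quotient and zeta values *)

Section LogGamma.
Context {R : realType}.
Implicit Types x y z d : R.

Definition zeta_sum (i m : nat) : R := \sum_(s < m) s.+1%:R ^- i.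

Lemma zeta_sum_le2 m : zeta_sum 2 m <= 2.
Proof.
suff bound k : zeta_sum 2 k.+1 <= 2 - k.+1%:R^-1.
  case: m => [|m]; first by rewrite /zeta_sum big_ord0.
  by apply: (le_trans (bound m)); rewrite gerBl invr_ge0.
elim: k => [|k IH].
  by rewrite /zeta_sum big_ord1 expr1n invr1; lra.
rewrite /zeta_sum big_ord_recr /= -/(zeta_sum 2 k.+1).
apply: (le_trans (lerD IH (lexx _))).
have k1 : 0 < k.+1%:R :> R by rewrite ltr0n.
rewrite -[k.+2%:R]natr1; move: (k.+1%:R : R) k1 => t t0.
rewrite -subr_ge0.
have -> : 2 - (t + 1)^-1 - (2 - t^-1 + (t + 1) ^- 2) = (t * (t + 1) ^+ 2)^-1.
  by field; apply/andP; split; rewrite gt_eqF //; lra.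
by rewrite invr_ge0 mulr_ge0 ?exprn_ge0 ?ltW //; lra.
Qed.

Lemma zeta_sum_le i m : (2 <= i)%N -> zeta_sum i m <= 2.
Proof.
move=> i2; apply: le_trans (zeta_sum_le2 m); apply: ler_sum => s _.
by rewrite lef_pV2 ?posrE ?exprn_gt0 ?ltr0n // ler_weXn2l // ler1n.
Qed.

Lemma cvg_zeta_sum i : (2 <= i)%N -> zeta_sum i m @[m --> \oo] --> zeta R i.
Proof.
move=> i2; have -> : zeta_sum i = series (fun m : nat => m.+1%:R ^- i).
  by apply/funext => m; rewrite /series /= big_mkord.
apply: nondecreasing_is_cvgn.
  by apply: nondecreasing_series => k _ _; rewrite invr_ge0 exprn_ge0.
exists 2 => _ [m _ <-].
by have := zeta_sum_le m i2; rewrite /zeta_sum /series /= big_mkord.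
Qed.

Definition power_gap x y (k : nat) : R := (x + y) ^+ k - x ^+ k - y ^+ k.

(** The beginning of the expansion of
    ln (Gamma (1 + x) Gamma (1 + y) / Gamma (1 + x + y)): expanding the
    logarithm of each factor of the product and summing over the factors
    produces one zeta value per degree.  The terms of degree one, which would
    involve the divergent harmonic series, cancel: power_gap x y 1 = 0. *)
Definition log_gamma_poly (N : nat) x y : R :=
  \sum_(j < N) (-1) ^+ j.+1 / j.+2%:R * power_gap x y j.+2 * zeta R j.+2.

Definition log_gamma_factor x y (s : nat) : R :=
  ln (1 + (x + y) / s.+1%:R) - ln (1 + x / s.+1%:R) - ln (1 + y / s.+1%:R).

Lemma half_div_succ z (s : nat) : `|z| <= 2^-1 -> `|z / s.+1%:R| <= 2^-1.
Proof.
move=> zh; apply: le_trans zh; rewrite normrM normfV normr_nat.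
by rewrite ler_pdivrMr ?ltr0n // ler_peMr // ler1n.
Qed.

Lemma half_1D_gt0 z : `|z| <= 2^-1 -> 0 < 1 + z.
Proof. by rewrite ler_norml => /andP[]; lra. Qed.

Lemma expR_log_gamma_factor x y s :
  `|x| <= 2^-1 -> `|y| <= 2^-1 -> `|x + y| <= 2^-1 ->
  expR (log_gamma_factor x y s) = gamma_factor x y s.
Proof.
move=> xh yh xyh; rewrite /log_gamma_factor !expRD !expRN !lnK ?posrE;
  try exact/half_1D_gt0/half_div_succ.
have x0 : 1 + x / s.+1%:R != 0 by exact/lt0r_neq0/half_1D_gt0/half_div_succ.
have y0 : 1 + y / s.+1%:R != 0 by exact/lt0r_neq0/half_1D_gt0/half_div_succ.
have s0 : s.+1%:R != 0 :> R by rewrite pnatr_eq0.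
have sE z : 1 + z / s.+1%:R = (s.+1%:R + z) / s.+1%:R.
  by rewrite mulrDl mulfV.
rewrite /gamma_factor; move: x0 y0; rewrite !sE !mulf_eq0 !negb_or.
move=> /andP[x0 _] /andP[y0 _]; move: (s.+1%:R) s0 x0 y0 => t s0 x0 y0.
by field; rewrite s0 x0 y0.
Qed.

Lemma log_gamma_factor_bound N x y d s :
  `|x| <= d -> `|y| <= d -> `|x + y| <= d -> d <= 2^-1 ->
  `|log_gamma_factor x y s -
    (ln1p_poly N.+1 ((x + y) / s.+1%:R) - ln1p_poly N.+1 (x / s.+1%:R)
     - ln1p_poly N.+1 (y / s.+1%:R))| <= 6 * d ^+ N.+2 * s.+1%:R ^- 2.
Proof.
move=> xd yd xyd dh.
have one z : `|z| <= d ->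
    `|ln (1 + z / s.+1%:R) - ln1p_poly N.+1 (z / s.+1%:R)| <=
    2 * d ^+ N.+2 * s.+1%:R ^- 2.
  move=> zd; have zh := le_trans zd dh.
  apply: (le_trans (ln1p_poly_bound N.+1 (half_div_succ s zh))).
  rewrite -mulrA ler_wpM2l // normrM exprMn; apply: ler_pM.
  - exact: exprn_ge0.
  - exact: exprn_ge0.
  - by rewrite lerXn2r ?nnegrE // (le_trans (normr_ge0 _) zd).
  - rewrite normfV normr_nat exprVn lef_pV2 ?posrE ?exprn_gt0 ?ltr0n //.
    by rewrite ler_weXn2l // ler1n.
have := (one _ xd, one _ yd, one _ xyd).
rewrite /log_gamma_factor.
move: (ln _) (ln _) (ln _) (ln1p_poly _ _) (ln1p_poly _ _) (ln1p_poly _ _).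
move=> a1 a2 a3 p1 p2 p3; rewrite !ler_norml.
have -> : 6 * d ^+ N.+2 * s.+1%:R ^- 2 = 3 * (2 * d ^+ N.+2 * s.+1%:R ^- 2).
  by rewrite !mulrA -natrM.
move: (2 * _ * _) => B [[/andP[? ?] /andP[? ?]] /andP[? ?]].
by apply/andP; split; lra.
Qed.

Definition log_gamma_sum N x y m : R :=
  \sum_(j < N) (-1) ^+ j.+1 / j.+2%:R * power_gap x y j.+2 * zeta_sum j.+2 m.

Lemma log_gamma_sumE N x y m : log_gamma_sum N x y m =
  \sum_(s < m) (ln1p_poly N.+1 ((x + y) / s.+1%:R) - ln1p_poly N.+1 (x / s.+1%:R)
     - ln1p_poly N.+1 (y / s.+1%:R)).
Proof.
rewrite /log_gamma_sum; under eq_bigr do rewrite /zeta_sum mulr_sumr.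
rewrite exchange_big /=; apply: eq_bigr => s _.
rewrite /ln1p_poly -!sumrB big_ord_recl /= !expr0 !expr1.
have -> : 1 / 1 * ((x + y) / s.+1%:R) - 1 / 1 * (x / s.+1%:R) -
  1 / 1 * (y / s.+1%:R) = 0 by rewrite divr1; ring.
rewrite add0r; apply: eq_bigr => j _.
by rewrite !expr_div_n /power_gap; ring.
Qed.

Lemma log_gamma_sum_bound N x y d m :
  `|x| <= d -> `|y| <= d -> `|x + y| <= d -> d <= 2^-1 ->
  `|\sum_(s < m) log_gamma_factor x y s - log_gamma_sum N x y m| <=
  12 * d ^+ N.+2.
Proof.
move=> xd yd xyd dh; rewrite log_gamma_sumE -sumrB.
apply: (le_trans (ler_norm_sum _ _ _)).
have d0 : 0 <= d by exact: le_trans xd.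
apply: (@le_trans _ _ (\sum_(s < m) 6 * d ^+ N.+2 * s.+1%:R ^- 2)).
  by apply: ler_sum => s _; exact: log_gamma_factor_bound.
rewrite -mulr_sumr -/(zeta_sum 2 m).
have -> : 12 * d ^+ N.+2 = 6 * d ^+ N.+2 * 2 by ring.
by apply: ler_wpM2l; [rewrite mulr_ge0 ?exprn_ge0 | exact: zeta_sum_le2].
Qed.

Lemma cvg_log_gamma_sum N x y :
  log_gamma_sum N x y m @[m --> \oo] --> log_gamma_poly N x y.
Proof.
rewrite /log_gamma_poly; elim: N => [|N IH].
  rewrite big_ord0; have -> : log_gamma_sum 0 x y = fun=> 0.
    by apply/funext => m; rewrite /log_gamma_sum big_ord0.
  exact: cvg_cst.
rewrite big_ord_recr; have -> : log_gamma_sum N.+1 x y = fun m =>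
    log_gamma_sum N x y m +
    (-1) ^+ N.+1 / N.+2%:R * power_gap x y N.+2 * zeta_sum N.+2 m.
  by apply/funext => m; rewrite /log_gamma_sum big_ord_recr.
by apply: cvgD => //; apply: cvgM; [exact: cvg_cst | exact: cvg_zeta_sum].
Qed.

Lemma expR_log_gamma x y m :
  `|x| <= 2^-1 -> `|y| <= 2^-1 -> `|x + y| <= 2^-1 ->
  gamma_product x y m = expR (\sum_(s < m) log_gamma_factor x y s).
Proof.
move=> xh yh xyh; rewrite expR_sum; apply: eq_bigr => s _.
by rewrite expR_log_gamma_factor.
Qed.

(** The estimate holds for each partial product with the same constant, so that
    the limit G is caught between two exponentials; this also yields 0 < G. *)
Lemma ln_gamma_bound N x y d G :
  `|x| <= d -> `|y| <= d -> `|x + y| <= d -> d <= 2^-1 ->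
  gamma_product x y m @[m --> \oo] --> G ->
  0 < G /\ `|ln G - log_gamma_poly N x y| <= 12 * d ^+ N.+2.
Proof.
move=> xd yd xyd dh GG; pose L := log_gamma_poly N x y.
pose B := 12 * d ^+ N.+2; rewrite -/B -/L.
have bounds m : expR (log_gamma_sum N x y m - B) <= gamma_product x y m <=
    expR (log_gamma_sum N x y m + B).
  rewrite expR_log_gamma; try exact: le_trans dh.
  have := log_gamma_sum_bound N m xd yd xyd dh; rewrite -/B !ler_expR ler_norml.
  by move=> /andP[? ?]; apply/andP; split; lra.
have cvgL c : expR (log_gamma_sum N x y m + c) @[m --> \oo] --> expR (L + c).
  apply: continuous_cvg; first exact: continuous_expR.
  by apply: cvgD; [exact: cvg_log_gamma_sum | exact: cvg_cst].
have lo : expR (L - B) <= G.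
  apply: (ler_cvg_to (cvgL (- B)) GG); apply: nearW => m.
  by case/andP: (bounds m).
have hi : G <= expR (L + B).
  apply: (ler_cvg_to GG (cvgL B)); apply: nearW => m.
  by case/andP: (bounds m).
have G0 : 0 < G by apply: lt_le_trans lo; exact: expR_gt0.
split=> //; rewrite -(lnK G0) !ler_expR in lo hi.
by rewrite ler_norml; apply/andP; split; lra.
Qed.

End LogGamma.

(** * Asymptotic expansions in powers of 1 / n *)

Section Decay.
Context {R : realType}.
Implicit Types (f g : nat -> R) (N M : nat) (p : {poly R}).

(** This is f n = O(n^(- N)), with a constant that can be computed with. *)
Definition decays N f :=
  exists C, \forall n \near \oo, `|f n| <= C * n%:R^-1 ^+ N.

Lemma eq_decays N f g : (\forall n \near \oo, f n = g n) ->
  decays N f -> decays N g.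
Proof.
move=> fg [C fC]; exists C; near=> n; have <- : f n = g n by near: n.
by near: n.
Unshelve. all: by end_near. Qed.

Lemma le_decays N f g : (\forall n \near \oo, `|f n| <= `|g n|) ->
  decays N g -> decays N f.
Proof.
move=> fg [C gC]; exists C; near=> n; apply: (@le_trans _ _ `|g n|).
  by near: n.
by near: n.
Unshelve. all: by end_near. Qed.

Lemma decaysD N f g : decays N f -> decays N g ->
  decays N (fun n => f n + g n).
Proof.
move=> [C fC] [D gD]; exists (C + D); near=> n.
by rewrite mulrDl; apply: (le_trans (ler_normD _ _)); apply: lerD; near: n.
Unshelve. all: by end_near. Qed.

Lemma decaysM N M f g : decays N f -> decays M g ->
  decays (N + M) (fun n => f n * g n).
Proof.
move=> [C fC] [D gD]; exists (C * D); near=> n.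
rewrite normrM exprD mulrACA; apply: ler_pM => //; near: n; [exact: fC|exact: gD].
Unshelve. all: by end_near. Qed.

Lemma decays_cst (c : R) : decays 0 (fun=> c).
Proof. by exists `|c|; apply: nearW => n; rewrite expr0 mulr1. Qed.

Lemma decaysZ N c f : decays N f -> decays N (fun n => c * f n).
Proof. by move=> fN; apply: (@decaysM 0); first exact: decays_cst. Qed.

Lemma decaysN N f : decays N f -> decays N (fun n => - f n).
Proof. by move=> [C fC]; exists C; near=> n; rewrite normrN; near: n.
Unshelve. all: by end_near. Qed.

Lemma decaysB N f g : decays N f -> decays N g ->
  decays N (fun n => f n - g n).
Proof. by move=> fN gN; apply: decaysD => //; exact: decaysN. Qed.

Lemma decays_invX N : decays N (fun n => n%:R^-1 ^+ N).
Proof.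
by exists 1; apply: nearW => n; rewrite mul1r ger0_norm // exprn_ge0 // invr_ge0.
Qed.

Lemma decaysX N f : decays 1 f -> decays N (fun n => f n ^+ N).
Proof.
move=> f1; elim: N => [|N IH]; first exact: decays_cst.
have := decaysM f1 IH; rewrite add1n; apply: eq_decays.
by apply: nearW => n; rewrite exprS.
Qed.

Lemma decays_leq N M f : (N <= M)%N -> decays M f -> decays N f.
Proof.
move=> NM [C fC]; exists `|C|; near=> n.
have n1 : 1 <= n%:R :> R by rewrite ler1n; near: n; exact: nbhs_infty_gt.
apply: (@le_trans _ _ (`|C| * n%:R^-1 ^+ M)).
  apply: (@le_trans _ _ (C * n%:R^-1 ^+ M)); first by near: n.
  by apply: ler_wpM2r; [rewrite exprn_ge0 // invr_ge0 | exact: ler_norm].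
apply: ler_wpM2l => //; apply: ler_wiXn2l => //.
by rewrite invf_le1 // (lt_le_trans _ n1).
Unshelve. all: by end_near. Qed.

Lemma decays_sum N k (F : nat -> nat -> R) :
  (forall i, (i < k)%N -> decays N (F i)) ->
  decays N (fun n => \sum_(i < k) F i n).
Proof.
elim: k => [|k IH] FN.
  exists 0; apply: nearW => n; by rewrite big_ord0 normr0 mul0r.
have FkN : decays N (fun n => \sum_(i < k) F i n).
  by apply: IH => i ik; apply: FN; rewrite ltnS ltnW.
apply: eq_decays (decaysD FkN (FN k (ltnSn k))).
by apply: nearW => n; rewrite big_ord_recr.
Qed.

Lemma decays_horner p : decays 0 (fun n => p.[n%:R^-1]).
Proof.
elim/poly_ind: p => [|p c IH].
  by apply: eq_decays (decays_cst 0); apply: nearW => n; rewrite horner0.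
have := decaysD (decaysM IH (decays_leq (leq0n 1) (decays_invX 1))) (decays_cst c).
by apply: eq_decays; apply: nearW => n; rewrite hornerMXaddC expr1.
Qed.

Lemma decays1_cst (c : R) : decays 1 (fun=> c) -> c = 0.
Proof.
move=> [C cC]; apply/eqP; apply: contraT => c0.
have cp : 0 < `|c| by rewrite normr_gt0.
near \oo => n.
have n0 : 0 < n%:R :> R by rewrite ltr0n; near: n; exact: nbhs_infty_gt.
suff : `|c| < `|c| by rewrite ltxx.
apply: (@le_lt_trans _ _ (C * n%:R^-1 ^+ 1)); first by near: n.
rewrite expr1 ltr_pdivrMr // mulrC -ltr_pdivrMr //.
near: n; exact: nbhs_infty_gtr.
Unshelve. all: by end_near. Qed.

(** Uniqueness of asymptotic coefficients: the constant term vanishes by letting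
    n tend to infinity, then a factor 1 / n can be removed. *)
Lemma decays_horner_coef N p : decays N (fun n => p.[n%:R^-1]) ->
  forall i, (i < N)%N -> p`_i = 0.
Proof.
elim: N p => [|N IH] p pN i; first by rewrite ltn0.
elim/poly_ind: p pN => [|p c _] pN; first by rewrite coef0.
have pX : decays 1 (fun n => p.[n%:R^-1] * n%:R^-1 ^+ 1).
  exact: (decaysM (decays_horner p) (decays_invX 1)).
have c0 : c = 0.
  apply: decays1_cst; apply: eq_decays (decaysB (decays_leq (ltn0Sn N) pN) pX).
  by apply: nearW => n; rewrite hornerMXaddC expr1 addrC addKr.
rewrite coefD coefMX coefC c0 if_same addr0; case: i => [//|i] /=.
rewrite ltnS => iN.
apply: IH => //; move: pN => [C pC]; exists C; near=> n.
have n0 : 0 < n%:R^-1 :> R.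
  by rewrite invr_gt0 ltr0n; near: n; exact: nbhs_infty_gt.
rewrite -(ler_pM2r n0) -mulrA -exprSr.
rewrite -[X in _ * X <= _](ger0_norm (ltW n0)) -normrM.
have -> : p.[n%:R^-1] * n%:R^-1 = (p * 'X + c%:P).[n%:R^-1].
  by rewrite hornerMXaddC c0 addr0.
by near: n.
Unshelve. all: by end_near. Qed.

End Decay.

Section Expansions.
Context {R : realType} (A : comAlgType rat) (phi : {rmorphism A -> R}).
Implicit Types (f g : nat -> R) (N : nat).

(** An expansion up to O(n^(- N)) whose coefficients lie in the image of phi.
    Keeping the coefficients in A makes the stability properties below ring
    computations in {poly A}; P is not truncated, as terms of degree at least N
    are harmless. *)
Definition expands N f := exists P : {poly A},
  decays N (fun n => f n - (map_poly phi P).[n%:R^-1]).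

Lemma eq_expands N f g : (\forall n \near \oo, f n = g n) ->
  expands N f -> expands N g.
Proof.
move=> fg [P fP]; exists P; apply: eq_decays fP; near=> n.
by congr (_ - _); near: n.
Unshelve. all: by end_near. Qed.

Lemma expands_decays N f : decays N f -> expands N f.
Proof.
move=> fN; exists 0; apply: eq_decays fN; apply: nearW => n.
by rewrite rmorph0 horner0 subr0.
Qed.

Lemma expands_horner N (P : {poly A}) :
  expands N (fun n => (map_poly phi P).[n%:R^-1]).
Proof.
exists P; exists 0; apply: nearW => n.
by rewrite subrr normr0 mul0r.
Qed.

Lemma expands_phi N (a : A) : expands N (fun=> phi a).
Proof.
apply: eq_expands (expands_horner N a%:P); apply: nearW => n.
by rewrite map_polyC hornerC.
Qed.

Lemma phi_rat (q : rat) : phi q%:A = ratr q.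
Proof. exact: (fmorph_eq_rat (phi \o in_alg A)). Qed.

Lemma expands_rat N (q : rat) : expands N (fun=> ratr q).
Proof. by rewrite -phi_rat; exact: expands_phi. Qed.

Lemma expands_invX N k : expands N (fun n => n%:R^-1 ^+ k).
Proof.
apply: eq_expands (expands_horner N 'X^k); apply: nearW => n.
by rewrite map_polyXn hornerXn.
Qed.

Lemma expandsD N f g : expands N f -> expands N g ->
  expands N (fun n => f n + g n).
Proof.
move=> [P fP] [Q gQ]; exists (P + Q); apply: eq_decays (decaysD fP gQ).
by apply: nearW => n; rewrite rmorphD hornerD; ring.
Qed.

Lemma expands_bounded N f : expands N f -> decays 0 f.
Proof.
move=> [P fP].
have := decaysD (decays_leq (leq0n N) fP) (decays_horner (map_poly phi P)).
by apply: eq_decays; apply: nearW => n; rewrite subrK.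
Qed.

Lemma expandsM N f g : expands N f -> expands N g ->
  expands N (fun n => f n * g n).
Proof.
move=> fE gE; have g0 := expands_bounded gE.
move: fE gE => [P fP] [Q gQ]; exists (P * Q).
have P0 := decays_horner (map_poly phi P).
have := decaysM fP g0; rewrite addn0 => /decaysD/(_ (decaysM P0 gQ)).
by apply: eq_decays; apply: nearW => n; rewrite rmorphM hornerM; ring.
Qed.

Lemma expandsX N f k : expands N f -> expands N (fun n => f n ^+ k).
Proof.
move=> fE; elim: k => [|k IH].
  by apply: eq_expands (expands_rat N 1); apply: nearW => n; rewrite rmorph1.
by apply: eq_expands (expandsM fE IH); apply: nearW => n; rewrite exprS.
Qed.

Lemma expands_sum N k (F : nat -> nat -> R) :
  (forall i, (i < k)%N -> expands N (F i)) ->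
  expands N (fun n => \sum_(i < k) F i n).
Proof.
elim: k => [|k IH] FE.
  apply: eq_expands (expands_rat N 0); apply: nearW => n.
  by rewrite big_ord0 rmorph0.
have FkE : expands N (fun n => \sum_(i < k) F i n).
  by apply: IH => i ik; apply: FE; rewrite ltnS ltnW.
apply: eq_expands (expandsD FkE (FE k (ltnSn k))).
by apply: nearW => n; rewrite big_ord_recr.
Qed.

(** As f tends to 0, a Taylor polynomial of the exponential suffices, and its
    coefficients are rational. *)
Lemma expands_expR N f : decays 1 f -> expands N f ->
  expands N (fun n => expR (f n)).
Proof.
move=> f1 fE.
have expE : expands N (fun n => exp_poly N (f n)).
  apply: (@expands_sum N N (fun i n => f n ^+ i / i`!%:R)) => i _.
  apply: expandsM; first exact: expandsX.
  apply: eq_expands (expands_rat N (i`!%:R^-1)); apply: nearW => n.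
  by rewrite fmorphV rmorph_nat.
have rem : decays N (fun n => expR (f n) - exp_poly N (f n)).
  apply: le_decays (decaysZ (expR 1) (decaysX N f1)).
  have [C fC] := f1; near=> n.
  rewrite [leRHS]normrM (ger0_norm (expR_ge0 1)) normrX.
  apply: exp_poly_bound; apply: (@le_trans _ _ (C * n%:R^-1 ^+ 1)).
    by near: n.
  rewrite expr1 ler_pdivrMr ?mul1r.
    by near: n; exact: nbhs_infty_ger.
  by rewrite ltr0n; near: n; exact: nbhs_infty_gt.
apply: eq_expands (expandsD (expands_decays rem) expE).
by apply: nearW => n; rewrite subrK.
Unshelve. all: by end_near. Qed.

End Expansions.

(** * The expansion of I(n) *)

Section ExpansionOfI.
Context {R : realType} (A : comAlgType rat) (phi : {rmorphism A -> R}).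

Lemma power_gapZ (u v e : R) j :
  power_gap (u * e) (v * e) j = power_gap u v j * e ^+ j.
Proof. by rewrite /power_gap -mulrDl !exprMn !mulrBl. Qed.

Lemma log_gamma_polyZ N (u v e : R) : log_gamma_poly N (u * e) (v * e) =
  \sum_(j < N) (-1) ^+ j.+1 / j.+2%:R * power_gap u v j.+2 * zeta R j.+2 *
    e ^+ j.+2.
Proof. by apply: eq_bigr => j _; rewrite power_gapZ; ring. Qed.

Lemma expands_log_gamma_poly N (z : nat -> A) (u v : rat) :
  (forall j, (j < N)%N -> phi (z j) = zeta R j.+2) ->
  expands phi N.+1
    (fun n => log_gamma_poly N (ratr u * n%:R^-1 : R) (ratr v * n%:R^-1)).
Proof.
move=> zE; pose q (j : nat) : rat :=
  (-1) ^+ j.+1 / j.+2%:R * ((u + v) ^+ j.+2 - u ^+ j.+2 - v ^+ j.+2).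
apply: (@eq_expands _ _ _ _
    (fun n => \sum_(j < N) ratr (q j) * phi (z j) * n%:R^-1 ^+ j.+2)).
  apply: nearW => n; rewrite log_gamma_polyZ; apply: eq_bigr => j _.
  rewrite zE // /power_gap /q 2!rmorphM !rmorphB !rmorphXn.
  by rewrite rmorphD fmorphV rmorph_nat rmorphN1.
apply: (@expands_sum _ _ _ _ N
  (fun j n => ratr (q j) * phi (z j) * n%:R^-1 ^+ j.+2)) => j _.
apply: expandsM; last exact: expands_invX.
by apply: expandsM; [exact: expands_rat | exact: expands_phi].
Qed.

Lemma decays_log_gamma_poly N (u v : R) :
  decays 1 (fun n => log_gamma_poly N (u * n%:R^-1 : R) (v * n%:R^-1)).
Proof.
pose c j := (-1) ^+ j.+1 / j.+2%:R * power_gap u v j.+2 * zeta R j.+2.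
apply: (@eq_decays _ _ (fun n => \sum_(j < N) c j * n%:R^-1 ^+ j.+2)).
  by apply: nearW => n; rewrite log_gamma_polyZ.
apply: (@decays_sum _ _ N (fun j n => c j * n%:R^-1 ^+ j.+2)) => j _.
by apply: decaysZ; apply: (@decays_leq _ _ j.+2) => //; exact: decays_invX.
Qed.

(** In the product formula for this moment, x = (i - M - 1) / n and
    y = (M - i) / n are rational multiples of 1 / n, with x + y = - 1 / n.  The
    logarithm of the moment therefore has the expansion log_gamma_poly x y, a
    polynomial in 1 / n with coefficients in the span of the zeta values. *)
Lemma expands_moment N M i (z : nat -> A) :
  (forall j, (j < N)%N -> phi (z j) = zeta R j.+2) -> (i < M.*2.+2)%N ->
  expands phi N.+1 (fun n => n.-1%:R *
    @coord_moment R n (i + (n.-1 - M.+1)) (M.*2.+1 - i + (n.-1 - M.+1))).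
Proof.
move=> zE iM; set g := (X in expands _ _ X).
pose u : rat := i%:R - M.+1%:R; pose v : rat := M%:R - i%:R.
pose L n : R := log_gamma_poly N (ratr u * n%:R^-1) (ratr v * n%:R^-1).
have uE : ratr u = i%:R - M.+1%:R :> R by rewrite rmorphB !rmorph_nat.
have vE : ratr v = M%:R - i%:R :> R by rewrite rmorphB !rmorph_nat.
have gL : \forall n \near \oo,
    0 < g n /\ `|ln (g n) - L n| <= 12 * (M.+1%:R * n%:R^-1) ^+ N.+2.
  near=> n.
  have nM : (M.+2.*2 <= n)%N by near: n; exact: nbhs_infty_ge.
  have n0 : n%:R != 0 :> R by rewrite pnatr_eq0; lia.
  have e0 : 0 <= n%:R^-1 :> R by rewrite invr_ge0.
  have norm_le (r : R) : `|r| <= M.+1%:R -> `|r * n%:R^-1| <= M.+1%:R * n%:R^-1.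
    by move=> rM; rewrite normrM (ger0_norm e0) ler_wpM2r.
  have i2M : i%:R <= M.+1%:R *+ 2 - 1 :> R.
    by rewrite -mulrnA lerBrDr natr1 ler_nat; lia.
  have M1 : M.+1%:R = M%:R + 1 :> R by rewrite natr1.
  apply: ln_gamma_bound.
  - apply: norm_le; rewrite uE ler_norml; have := ler0n R i.
    by move=> ?; apply/andP; split; lra.
  - apply: norm_le; rewrite vE ler_norml; have := ler0n R i.
    by move=> ?; apply/andP; split; lra.
  - rewrite -mulrDl; apply: norm_le; rewrite uE vE M1 ler_norml.
    by have := ler0n R M; move=> ?; apply/andP; split; lra.
  - rewrite ler_pdivrMr; last by rewrite ltr0n; lia.
    by rewrite ler_pdivlMl // -natrM ler_nat; lia.
  rewrite /g; set k := (i + _)%N; set l := (M.*2.+1 - i + _)%N.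
  have kE : k.+1%:R - n%:R = i%:R - M.+1%:R :> R.
    apply/eqP; rewrite subr_eq addrAC eq_sym subr_eq -!natrD eqr_nat; lia.
  have lE : l.+1%:R - n%:R = M%:R - i%:R :> R.
    apply/eqP; rewrite subr_eq addrAC eq_sym subr_eq -!natrD eqr_nat; lia.
  have := @cvg_gamma_product_moment R n k l.
  rewrite kE lE -uE -vE.
  have -> : (k + l + 2)%:R - n%:R = n.-1%:R :> R.
    apply/eqP; rewrite subr_eq -natrD eqr_nat; lia.
  by apply; lia.
have lnE : decays N.+2 (fun n => ln (g n) - L n).
  exists (12 * M.+1%:R ^+ N.+2); near=> n.
  rewrite -mulrA -exprMn.
  have : 0 < g n /\ `|ln (g n) - L n| <= 12 * (M.+1%:R * n%:R^-1) ^+ N.+2.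
    by near: n.
  by case.
apply: (@eq_expands _ _ _ _ (fun n => expR (ln (g n)))).
  near=> n; rewrite lnK //.
  have : 0 < g n /\ `|ln (g n) - L n| <= 12 * (M.+1%:R * n%:R^-1) ^+ N.+2.
    by near: n.
  by rewrite posrE => -[].
have lnL n : ln (g n) - L n + L n = ln (g n) by rewrite subrK.
apply: expands_expR.
  have := decaysD (decays_leq (ltn0Sn N.+1) lnE)
    (decays_log_gamma_poly N (ratr u) (ratr v)).
  by apply: eq_decays; apply: nearW.
have := expandsD (expands_decays phi (decays_leq (leqnSn N.+1) lnE))
  (expands_log_gamma_poly u v zE).
by apply: eq_expands; apply: nearW.
Unshelve. all: by end_near. Qed.

Lemma expands_int_I N (z : nat -> A) :
  (forall j, (j < N)%N -> phi (z j) = zeta R j.+2) ->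
  expands phi N.+1 (@int_I R).
Proof.
move=> zE; have [c cE] := @coord_integral_expansion R N.
pose J n : R := int01 (fun x : R =>
  (acoord n x * bcoord n x) ^+ n.-1 * (acoord n x + bcoord n x)).
pose E i n : R :=
  @coord_moment R n (i + (n.-1 - N.+1)) (N.*2.+1 - i + (n.-1 - N.+1)).
pose rem n : R := J n - \sum_(i < N.*2.+2) ratr (c i) * E i n.
pose K : nat := (N.+1 * 8)%N.
have rem_decays : decays N.+1 (fun n => n.-1%:R * rem n).
  apply: (@decays_leq _ _ N.*2.+1); first by rewrite ltnS -addnn leq_addr.
  exists (2 * K%:R ^+ N.+1.*2); near=> n.
  have nK : (K <= n)%N by near: n; exact: nbhs_infty_ge.
  have n0 : n%:R != 0 :> R by rewrite pnatr_eq0; move: nK; rewrite /K; lia.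
  (* About half of the exponent n - 1 is spent on the powers of the gap. *)
  pose m := (n %/ (N.+1 * 4))%N.
  have m_gt0 : (0 < m)%N by rewrite divn_gt0 //; move: nK; rewrite /K; lia.
  have nm : (n <= K * m)%N.
    have := ltn_ceil n (isT : (0 < N.+1 * 4)%N); rewrite -/m /K; nia.
  have mn : (m * (N.+1 * 4) <= n)%N by exact: leq_trunc_div.
  have m_inv : m%:R^-1 <= K%:R * n%:R^-1 :> R.
    rewrite ler_pdivlMr; last by rewrite ltr0n; lia.
    by rewrite mulrC ler_pdivrMr ?ltr0n // -natrM ler_nat.
  have n_gt0 : (0 < n)%N by lia.
  have := cE n m n_gt0 m_gt0 ltac:(move: nK; rewrite /K; nia).
  rewrite -/(J n) -/(rem n) => rem_le.
  rewrite normrM normr_nat.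
  apply: (@le_trans _ _ (n%:R * (2 * (K%:R * n%:R^-1) ^+ N.+1.*2))).
    apply: ler_pM => //; first by rewrite ler_nat leq_pred.
    apply: (le_trans rem_le); apply: ler_wpM2l => //.
    by rewrite -exprVn lerXn2r ?nnegrE ?mulr_ge0 ?invr_ge0.
  rewrite exprMn doubleS (exprS (n%:R^-1) N.*2.+1).
  rewrite le_eqVlt; apply/predU1P; left.
  move: (n%:R^-1 ^+ N.*2.+1) (K%:R ^+ N.*2.+2) => s t.
  by rewrite mulrCA -mulrA; congr (_ * _); rewrite mulrCA mulVKf.
have sumE : expands phi N.+1 (fun n =>
    \sum_(i < N.*2.+2) ratr (c i) * (n.-1%:R * E i n)).
  apply: (@expands_sum _ _ _ _ _ (fun i n => ratr (c i) * (n.-1%:R * E i n))).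
  move=> i iN; apply: expandsM; first exact: expands_rat.
  exact: (expands_moment zE).
have IE : \forall n \near \oo, ratr 1 + (ratr (- 2^-1) *
    (\sum_(i < N.*2.+2) ratr (c i) * (n.-1%:R * E i n)) +
    ratr (- 2^-1) * (n.-1%:R * rem n)) = int_I R n.
  near=> n; rewrite int_I_coord; last by near: n; exact: nbhs_infty_gt.
  rewrite -/(J n) rmorph1 rmorphN fmorphV rmorph_nat /rem.
  have -> : \sum_(i < N.*2.+2) ratr (c i) * (n.-1%:R * E i n) =
      n.-1%:R * \sum_(i < N.*2.+2) ratr (c i) * E i n.
    by rewrite mulr_sumr; apply: eq_bigr => i _; rewrite mulrCA.
  by move: (\sum_(_ < _) _) => S; field.
apply: (eq_expands IE); apply: expandsD; first exact: expands_rat.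
apply: expandsD; apply: expandsM => //; try exact: expands_rat.
exact: expands_decays.
Unshelve. all: by end_near. Qed.

End ExpansionOfI.

(** Two expansions of the same function to the same order have the same
    coefficients. *)
Lemma asymptotic_series_coef (R : realType) (A : comAlgType rat)
    (phi : {rmorphism A -> R}) (f c : nat -> R) N j :
  asymptotic_series f c -> expands phi N.+1 f -> (j <= N)%N ->
  exists a : A, c j = phi a.
Proof.
move=> fc [P fP] jN; exists P`_j.
have fcN : decays N.+1 (fun n => f n - (\poly_(i < N.+1) c i).[n%:R^-1]).
  have /eqO_exP[C _ fC] := fc N; exists C; near=> n.
  rewrite horner_poly.
  have : `|f n - \sum_(j < N.+1) c j * n%:R ^- j| <= C * `|n%:R ^- N.+1|.
    by near: n.
  rewrite -exprVn [`|_ ^+ _|]ger0_norm ?exprn_ge0 ?invr_ge0 //.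
  by under eq_bigr do rewrite -exprVn.
have gap : decays N.+1
    (fun n => (map_poly phi P - \poly_(i < N.+1) c i).[n%:R^-1]).
  apply: eq_decays (decaysB fcN fP); apply: nearW => n.
  by rewrite hornerD hornerN; ring.
have := decays_horner_coef gap (jN : (j < N.+1)%N).
by rewrite coefB coef_map coef_poly ltnS jN => /eqP; rewrite subr_eq0 => /eqP.
Unshelve. all: by end_near. Qed.

Theorem corollary1 (R : realType) (I_ : nat -> R)
    (hI : asymptotic_series (@int_I R) I_) (p : nat) (hp : (2 <= p)%N) :
  is_rat_poly_in_zetas (I_ p).
Proof.
pose phi : {rmorphism mpoly.mpoly p rat -> R} :=
  mpoly.mmap (@ratr R) (fun i : 'I_p => zeta R i.+2).
(* An expansion up to O(n^(- p - 1)) only involves zeta 2, ..., zeta (p + 1). *)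
pose z (j : nat) : mpoly.mpoly p rat :=
  if insub j is Some i then mpolyX rat (mnm1 i) else 0.
have zE j : (j < p)%N -> phi (z j) = zeta R j.+2.
  move=> jp; rewrite /z insubT /phi /= mmapX mmap1U.
  by [].
have [P PE] := asymptotic_series_coef hI (expands_int_I zE) (leqnn p).
by exists p, P.
Qed.
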